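(* Let $\varepsilon>0$ be a real number. Let $S_n:=X_1+\cdots+X_n$, where $X_1,\dots,X_n$ are independent zero-mean sub-exponential real-valued random variables. Let $$B_{n,1;\varepsilon}^2:=\varepsilon\sum_{i=1}^n\|X_i\|_{\psi_{11};\varepsilon}^2\quad\text{and}\quad M_{n,1;\varepsilon}:=\max_{1\le i\le n}\|X_i\|_{\psi_{11};\varepsilon},$$ and suppose that $M_{n,1;\varepsilon}\in(0,\infty)$ (equivalently, $B_{n,1;\varepsilon}^2\in(0,\infty)$). Then for all real $x\ge0$ $$\mathsf P(S_n\ge x)\le\begin{cases}\exp\Big(-\dfrac{x^2}{4B_{n,1;\varepsilon}^2}\Big)&\text{if } x\le\dfrac{2B_{n,1;\varepsilon}^2}{M_{n,1;\varepsilon}},\\[2mm]\exp\Big(-\Big(\dfrac{x}{M_{n,1;\varepsilon}}-\dfrac{B_{n,1;\varepsilon}^2}{M_{n,1;\varepsilon}^2}\Big)\Big)&\text{if } x\ge\dfrac{2B_{n,1;\varepsilon}^2}{M_{n,1;\varepsilon}},\end{cases}$$ and the right-hand side of this inequality is at most $$\exp\Big(-\min\Big(\frac{x^2}{4B_{n,1;\varepsilon}^2},\frac{x}{2M_{n,1;\varepsilon}}\Big)\Big).$$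
   Context: For $u\in[0,\infty)$, let $\psi_1(u):=e^u-1$ and $\psi_{11}(u):=e^u-1-u$. For $f\in\{\psi_1,\psi_{11}\}$, a real $\varepsilon>0$, and a real-valued random variable $X$, let $\|X\|_{f;\varepsilon}:=\inf\{x>0\colon\mathsf E f(|X|/x)\le\varepsilon\}$, with $\inf\emptyset:=\infty$. A random variable $X$ is called sub-exponential if $\|X\|_{\psi_1;1}<\infty$ (light tails); equivalently, $\|X\|_{\psi_{11};\varepsilon}<\infty$ for any given $\varepsilon>0$. *)

(* Defs.v *)
From mathcomp Require Import all_boot all_order all_algebra.
From mathcomp Require Import all_classical all_reals all_analysis.

Set Implicit Arguments.
Unset Strict Implicit.
Unset Printing Implicit Defensive.

Import Order.TTheory GRing.Theory Num.Theory.

Local Open Scope classical_set_scope.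
Local Open Scope ring_scope.

(* psi1 and psi11 are only ever evaluated at nonnegative arguments. *)
Definition psi1 (R : realType) (u : R) : R := expR u - 1.

Definition psi11 (R : realType) (u : R) : R := expR u - 1 - u.

(* The library's ereal_inf satisfies ereal_inf set0 = +oo. *)
Definition orlicz_norm (d : measure_display) (T : measurableType d)
    (R : realType) (P : probability T R) (f : R -> R) (eps : R) (X : T -> R) :
    \bar R :=
  ereal_inf [set x%:E | x in
    [set x : R | 0 < x /\ ('E_P[fun t => f (`|X t| / x)%R] <= eps%:E)%E]].

Definition sub_exponential (d : measure_display) (T : measurableType d)
    (R : realType) (P : probability T R) (X : T -> R) : Prop :=
  (orlicz_norm P (@psi1 R) 1 X < +oo)%E.

(* Mutual (not merely pairwise) independence: the product rule holds for every
   subfamily J and all Borel sets A i. *)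
Definition independent_RVs (d : measure_display) (T : measurableType d)
    (R : realType) (P : probability T R) (I : finType)
    (X : I -> {RV P >-> R}) : Prop :=
  forall (J : {set I}) (A : I -> set R),
    (forall i, measurable (A i)) ->
    P [set t | forall i, i \in J -> A i (X i t)] =
    (\prod_(i in J) P (X i @^-1` A i))%E.

(* The square B^2 itself, kept in the extended reals since the norms are. *)
Definition Bsq (d : measure_display) (T : measurableType d)
    (R : realType) (P : probability T R) (n : nat) (eps : R)
    (X : 'I_n -> T -> R) : \bar R :=
  (eps%:E * \sum_(i < n) (orlicz_norm P (@psi11 R) eps (X i)) ^+ 2)%E.

(* For n = 0 this is -oo, so that 0 < Mmax P eps X forces 1 <= n. *)
Definition Mmax (d : measure_display) (T : measurableType d)
    (R : realType) (P : probability T R) (n : nat) (eps : R)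
    (X : 'I_n -> T -> R) : \bar R :=
  (\big[maxe/-oo]_(i < n) orlicz_norm P (@psi11 R) eps (X i))%E.

(* Main.v *)
Require Import Defs.
From HB Require Import structures.
From mathcomp Require Import all_boot all_order all_algebra.
From mathcomp Require Import all_classical all_reals all_analysis.
From mathcomp Require Import measurable_realfun ring lra.

Import Order.TTheory GRing.Theory Num.Theory.
Import numFieldNormedType.Exports.

Local Open Scope classical_set_scope.
Local Open Scope ring_scope.

(** The proof is the exponential Markov (Chernoff) method. Write [a i] for the
    psi11-norm of [X i]. The power series of psi11 starts at the quadratic term
    and has nonnegative coefficients, so psi11 grows at least quadratically: for
    [0 <= s <= 1], psi11 (s u) <= s^2 psi11 |u| ([psi11M_le]). With [s = h c]
    and [u = X i / c], where [c] is admissible in the infimum defining the norm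
    and [h c <= 1], the mean of exp (h X) = 1 + h X + psi11 (h X) is at most
    1 + (h c)^2 eps <= exp (eps (h c)^2), because [X i] is centred
    ([mgf_le_psi11]). Letting [c] decrease to [a i] gives
    E exp (h X_i) <= exp (eps (h a_i)^2) whenever [h a_i < 1]
    ([mgf_le_orlicz_norm]).

    Independence turns E exp (h S) into the product of these means
    ([expectation_prod_indep]), hence P (S >= x) <= exp (- h x + h^2 B^2) for
    all [h < 1 / M], and for [h = 1 / M] by continuity in [h]
    ([tail_le_expR]). The unconstrained minimiser of the exponent is
    [h = x / (2 B^2)]; it is admissible exactly when [x <= 2 B^2 / M], and
    otherwise [h = 1 / M] is the best choice. These are the two regimes of the
    bound.

    Independence is only given as a product rule for events. It is extended to
    products of nonnegative functions one factor at a time: with all other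
    factors fixed, both sides of the product formula are integrals of the
    chosen factor against a weight, and the weights agree on indicators
    ([eq_weight_integral]). *)

Set Implicit Arguments.
Unset Strict Implicit.
Unset Printing Implicit Defensive.

(** * The functions psi1 and psi11 *)

(** Comparing the Taylor series of psi11 term by term replaces any discussion of
    the monotonicity of u |-> psi11 u / u^2. *)
Lemma psi11_le_termwise (R : realType) (c x y : R) :
  (forall k, x ^+ k.+2 <= c * y ^+ k.+2) -> psi11 x <= c * psi11 y.
Proof.
move=> le_xy.
have psi11_lim (z : R) :
    \sum_(k < n) (z ^+ k.+2 / k.+2`!%:R) @[n --> \oo] --> psi11 z.
  have -> : (fun n => \sum_(k < n) (z ^+ k.+2 / k.+2`!%:R)) =
      (fun n => series (exp_coeff z) (n + 2)%N - 1 - z).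
    apply/funext => n; rewrite /series/= addn2 big_mkord.
    rewrite big_ord_recl big_ord_recl /exp_coeff /=.
    rewrite expr0 expr1 !fact0 factS fact0 !divr1.
    ring.
  apply: cvgB; last exact: cvg_cst.
  apply: cvgB; last exact: cvg_cst.
  by have := @is_cvg_series_exp_coeff R z; rewrite -(cvg_shiftn 2).
have lim_cy : c * \sum_(k < n) (y ^+ k.+2 / k.+2`!%:R) @[n --> \oo] -->
    c * psi11 y by exact: cvgMl_tmp.
apply: (ler_cvg_to (psi11_lim x) lim_cy).
apply: nearW => n; rewrite mulr_sumr ler_sum// => k _.
by rewrite mulrA ler_wpM2r ?invr_ge0.
Qed.

(** Each monomial of degree at least 2 gains a factor s^2 under scaling by
    [s <= 1]; the absolute value also absorbs the sign of the odd powers. *)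
Lemma psi11M_le (R : realType) (s u : R) : 0 <= s <= 1 ->
  psi11 (s * u) <= s ^+ 2 * psi11 `|u|.
Proof.
move=> /andP[s0 s1]; apply: psi11_le_termwise => k.
apply: le_trans (ler_norm _) _.
rewrite exprMn normrM !normrX (ger0_norm s0) ler_wpM2r ?exprn_ge0//.
by rewrite -addn2 exprD ler_piMl ?sqr_ge0// exprn_ile1.
Qed.

Lemma psi1_ge0 (R : realType) (u : R) : 0 <= u -> 0 <= psi1 u.
Proof. by move=> u0; rewrite subr_ge0 -expR0 ler_expR. Qed.

Lemma psi11_ge0 (R : realType) (u : R) : 0 <= psi11 u.
Proof. by rewrite /psi11 -addrA -opprD subr_ge0 expR_ge1Dx. Qed.

Lemma measurable_psi1 (R : realType) : measurable_fun setT (@psi1 R).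
Proof. exact: measurable_funB. Qed.

Lemma measurable_psi11 (R : realType) : measurable_fun setT (@psi11 R).
Proof. by apply: measurable_funB => //; exact: measurable_funB. Qed.

(** The pointwise bound behind the estimate of the moment generating function:
    [psi11M_le] with [s = h c] and [u = x / c]. *)
Lemma expR_le_psi11 (R : realType) (h c x : R) :
  0 <= h -> 0 < c -> h * c <= 1 ->
  expR (x * h) <= 1 + x * h + (h * c) ^+ 2 * psi11 (`|x| / c).
Proof.
move=> h0 c0 hc1.
have hc01 : 0 <= h * c <= 1 by rewrite hc1 mulr_ge0// ltW.
have := psi11M_le (x / c) hc01.
rewrite (_ : h * c * (x / c) = x * h); last by field; rewrite gt_eqF.
by rewrite normrM normfV (gtr0_norm c0) {1}/psi11; lra.
Qed.

(** * Moment generating functions and Orlicz norms *)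

Lemma measurable_normr_div d (T : measurableType d) (R : realType)
    (X : T -> R) (x : R) :
  measurable_fun setT X -> measurable_fun setT (fun t => `|X t| / x).
Proof. by move=> mX; apply: measurable_funM => //; exact: measurableT_comp. Qed.

(** Integrability is what gives meaning to the hypothesis of zero mean; it
    follows from u <= psi1 u. *)
Lemma sub_exponential_integrable d (T : measurableType d) (R : realType)
    (P : probability T R) (X : {RV P >-> R}) :
  sub_exponential P X -> P.-integrable setT (EFin \o X).
Proof.
move=> /ereal_inf_lt[_ [x [x0 Ex] <-] _].
have mX : measurable_fun setT X by [].
apply/integrableP; split; first exact/measurable_EFinP.
have mf : measurable_fun setT (fun t => psi1 (`|X t| / x)).
  apply: measurableT_comp; first exact: measurable_psi1.
  exact: measurable_normr_div.
have f0 t : 0 <= psi1 (`|X t| / x) by rewrite psi1_ge0// divr_ge0// ltW.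
apply: (@le_lt_trans _ _ (\int[P]_t (x%:E * (psi1 (`|X t| / x))%:E))%E).
  apply: ge0_le_integral => //.
  - by apply: measurableT_comp => //; exact/measurable_EFinP.
  - by apply: measurable_funeM; exact/measurable_EFinP.
  - move=> t _; rewrite lee_fin -ler_pdivrMl// mulrC.
    by rewrite lerBrDl expR_ge1Dx.
rewrite ge0_integralZl_EFin ?ltW//; last 2 first.
- by move=> t _; rewrite lee_fin.
- exact/measurable_EFinP.
move: Ex; rewrite unlock => Ex.
apply: (@le_lt_trans _ _ (x%:E * 1)%E); last by rewrite mule1 ltry.
by rewrite lee_pmul2l.
Qed.

(** The linear term of [expR_le_psi11] integrates to zero, and
    1 + y <= exp y. *)
Lemma mgf_le_psi11 d (T : measurableType d) (R : realType)
    (P : probability T R) (X : {RV P >-> R}) (eps h c : R) :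
  P.-integrable setT (EFin \o X) -> ('E_P[X] = 0)%E ->
  0 <= h -> 0 < c -> h * c <= 1 ->
  ('E_P[fun t => psi11 (`|X t| / c)] <= eps%:E)%E ->
  ('M_P X h <= (expR (eps * (h * c) ^+ 2))%:E)%E.
Proof.
move=> iX EX h0 c0 hc1; rewrite unlock => Ec; rewrite /mmt_gen_fun unlock.
set psi := fun t => psi11 (`|X t| / c).
have mX : measurable_fun setT X by [].
have mpsi : measurable_fun setT psi.
  apply: measurableT_comp; first exact: measurable_psi11.
  exact: measurable_normr_div.
have psi0 t : 0 <= psi t by exact: psi11_ge0.
have ipsi : P.-integrable setT (EFin \o psi).
  apply/integrableP; split; first exact/measurable_EFinP.
  under eq_integral => t _ do rewrite /= ger0_norm//.
  exact: le_lt_trans Ec (ltry _).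
have i1 : P.-integrable setT (EFin \o (fun t => 1 + X t * h)).
  rewrite (_ : EFin \o _ = cst 1%:E \+ (fun t => (X t)%:E * h%:E))%E//.
  apply: integrableD => //; last exact: integrableZr.
  exact: finite_measure_integrable_cst.
have E1 : (\int[P]_t (1 + X t * h)%:E = 1)%E.
  under eq_integral do rewrite EFinD EFinM.
  rewrite integralD//; last exact: integrableZr.
  - rewrite integral_cst//= probability_setT mule1 integralZr//.
    by move: EX; rewrite unlock => ->; rewrite mul0e adde0.
  - exact: finite_measure_integrable_cst.
apply: (@le_trans _ _
  (\int[P]_t ((1 + X t * h)%:E + ((h * c) ^+ 2)%:E * (psi t)%:E))%E).
  apply: ge0_le_integral => //.
  - by move=> t _; rewrite lee_fin expR_ge0.
  - by apply/measurable_EFinP; apply: (measurableT_comp (f := expR)).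
  - apply: emeasurable_funD; first exact: measurable_int i1.
    by apply: measurable_funeM; exact/measurable_EFinP.
  - by move=> t _; rewrite lee_fin expR_le_psi11.
rewrite integralD//; last exact: integrableZl.
rewrite E1 integralZl//.
apply: (@le_trans _ _ (1 + ((h * c) ^+ 2)%:E * eps%:E)%E).
  by rewrite leeD2l// lee_wpmul2l// lee_fin sqr_ge0.
by rewrite -EFinM -EFinD lee_fin mulrC expR_ge1Dx.
Qed.

Section orlicz_norm.
Context d (T : measurableType d) (R : realType) (P : probability T R).
Implicit Types (X : {RV P >-> R}) (eps : R).

Lemma orlicz_norm_ge0 (f : R -> R) eps (X : T -> R) :
  (0 <= orlicz_norm P f eps X)%E.
Proof. by apply: le_ereal_inf_tmp => _ [x [x0 _] <-]; rewrite lee_fin ltW. Qed.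

Lemma orlicz_norm_lt (f : R -> R) eps (X : T -> R) (c : R) :
  (orlicz_norm P f eps X < c%:E)%E ->
  exists2 c', 0 < c' < c & ('E_P[fun t => f (`|X t| / c')%R] <= eps%:E)%E.
Proof.
move=> /ereal_inf_lt[_ [c' [c'0 Ec'] <-]]; rewrite lte_fin => c'c.
by exists c' => //; rewrite c'0.
Qed.

(** If E psi1 (|X| / x) <= 1, then replacing x by x / s with [s <= 1] gains a
    factor s^2 in the mean of psi11 <= psi1, and s = min (1, eps) brings this
    mean below eps. *)
Lemma sub_exponential_psi11_norm_lty eps X : 0 < eps ->
  sub_exponential P X -> (orlicz_norm P (@psi11 R) eps X < +oo)%E.
Proof.
move=> eps0 /ereal_inf_lt[_ [x [x0 Ex] <-] _].
pose s := Num.min 1 eps.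
have s0 : 0 < s by rewrite lt_min ltr01.
have s1 : s <= 1 by rewrite ge_min lexx.
have mX : measurable_fun setT X by [].
apply: (@le_lt_trans _ _ (x / s)%:E); last exact: ltry.
apply: ereal_inf_lbound; exists (x / s) => //; split; first exact: divr_gt0.
have mpsi1 : measurable_fun setT (fun t => psi1 (`|X t| / x)).
  apply: measurableT_comp; first exact: measurable_psi1.
  exact: measurable_normr_div.
have psi1X_ge0 t : 0 <= psi1 (`|X t| / x) by rewrite psi1_ge0// divr_ge0// ltW.
move: Ex; rewrite unlock => Ex.
apply: (@le_trans _ _ (\int[P]_t ((s ^+ 2)%:E * (psi1 (`|X t| / x))%:E))%E).
  apply: ge0_le_integral => //.
  - by move=> t _; rewrite lee_fin psi11_ge0.
  - apply/measurable_EFinP; apply: measurableT_comp.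
      exact: measurable_psi11.
    exact: measurable_normr_div.
  - by apply: measurable_funeM; exact/measurable_EFinP.
  - move=> t _; rewrite -EFinM lee_fin.
    rewrite (_ : `|X t| / (x / s) = s * (`|X t| / x)); last first.
      by field; rewrite !gt_eqF.
    apply: le_trans (psi11M_le _ _) _; first by rewrite ltW.
    have u0 : 0 <= `|X t| / x by rewrite divr_ge0// ltW.
    by rewrite ger0_norm// ler_wpM2l ?sqr_ge0// /psi11 /psi1 lerBlDr lerDl.
rewrite ge0_integralZl_EFin ?sqr_ge0//; last 2 first.
- by move=> t _; rewrite lee_fin.
- exact/measurable_EFinP.
apply: (@le_trans _ _ ((s ^+ 2)%:E * 1)%E).
  by rewrite lee_wpmul2l// lee_fin sqr_ge0.
rewrite mule1 lee_fin; apply: (@le_trans _ _ s); last first.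
  by rewrite ge_min lexx orbT.
by rewrite expr2 ler_piMl// ltW.
Qed.

(** Passing to the limit [c -> a] from the right avoids deciding whether the
    infimum in the norm is attained, and covers [a = 0]. *)
Lemma mgf_le_orlicz_norm X eps (h a : R) :
  0 <= eps -> sub_exponential P X -> ('E_P[X] = 0)%E ->
  orlicz_norm P (@psi11 R) eps X = a%:E -> 0 < h -> h * a < 1 ->
  ('M_P X h <= (expR (eps * (h * a) ^+ 2))%:E)%E.
Proof.
move=> eps0 subX EX normX h0 ha1.
have bnd_cvg : (expR (eps * (h * c) ^+ 2))%:E @[c --> a^'+] -->
    (expR (eps * (h * a) ^+ 2))%:E.
  apply: cvg_EFin; first exact: nearW.
  apply: cvg_at_right_filter.
  apply: continuous_cvg; first exact: continuous_expR.
  by apply: cvgMl_tmp; apply: cvgM; apply: cvgMl_tmp; exact: cvg_id.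
apply: (cvge_to_ge bnd_cvg).
near=> c.
have ac : a < c by near: c; exact: nbhs_right_gt.
have hc1 : h * c <= 1.
  rewrite mulrC -ler_pdivlMr// ltW//; near: c; apply: nbhs_right_lt.
  by rewrite ltr_pdivlMr// mulrC.
have [|c' /andP[c'0 c'c] Ec'] := @orlicz_norm_lt (@psi11 R) eps X c.
  by rewrite normX lte_fin.
have hc'1 : h * c' <= 1 by apply: le_trans hc1; rewrite ler_pM2l// ltW.
have iX := sub_exponential_integrable subX.
apply: le_trans (mgf_le_psi11 iX EX (ltW h0) c'0 hc'1 Ec') _.
have c0 := lt_trans c'0 c'c.
rewrite lee_fin ler_expR ler_wpM2l// !exprMn ler_wpM2l ?sqr_ge0//.
by rewrite ler_sqr ?nnegrE ltW.
Unshelve. all: by end_near. Qed.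

End orlicz_norm.

(** * Expectation of products of independent variables *)

Import HBNNSimple.

(** Approximating [f] by simple functions on the target space of [X] keeps the
    approximants functions of [X], so that agreement of the weights on the
    events [X \in A] suffices. The weights are real-valued so that their
    products with the approximants converge. *)
Lemma eq_weight_integral d (T : measurableType d) (R : realType)
    (mu : {measure set T -> \bar R}) (X : T -> R) (g1 g2 : T -> R) :
  measurable_fun setT X ->
  measurable_fun setT g1 -> measurable_fun setT g2 ->
  (forall t, 0 <= g1 t) -> (forall t, 0 <= g2 t) ->
  (forall A, measurable A ->
    (\int[mu]_t (\1_A (X t) * g1 t)%:E =
     \int[mu]_t (\1_A (X t) * g2 t)%:E)%E) ->
  forall f : R -> R, measurable_fun setT f -> (forall r, 0 <= f r) ->
  (\int[mu]_t (f (X t) * g1 t)%:E = \int[mu]_t (f (X t) * g2 t)%:E)%E.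
Proof.
move=> mX mg1 mg2 g10 g20 eq12 f mf f0.
have mEf : measurable_fun setT (EFin \o f) by exact/measurable_EFinP.
pose h := nnsfun_approx measurableT mEf.
have limE (g : T -> R) : measurable_fun setT g -> (forall t, 0 <= g t) ->
    (\int[mu]_t (f (X t) * g t)%:E =
     limn (fun n => \int[mu]_t (h n (X t) * g t)%:E))%E.
  move=> mg g0; rewrite -monotone_convergence//.
  - apply: eq_integral => t _; apply/esym/cvg_lim => //.
    under eq_fun do rewrite EFinM.
    rewrite EFinM; apply: cvgeZr => //.
    have h_cvg := @cvg_nnsfun_approx _ _ R _ measurableT (EFin \o f) mEf.
    by apply: h_cvg => // x _; rewrite lee_fin.
  - move=> n; apply/measurable_EFinP; apply: measurable_funM => //.
    exact: measurableT_comp.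
  - by move=> n t _; rewrite lee_fin mulr_ge0.
  - move=> t _ m n mn; rewrite lee_fin ler_wpM2r//.
    exact/lefP/nd_nnsfun_approx.
rewrite !limE//; congr (limn _); apply/funext => n.
have sumE (g : T -> R) : measurable_fun setT g -> (forall t, 0 <= g t) ->
    (\int[mu]_t (h n (X t) * g t)%:E = \sum_(y \in range (h n))
      y%:E * \int[mu]_t (\1_(h n @^-1` [set y]) (X t) * g t)%:E)%E.
  move=> mg g0.
  have m1 y : measurable_fun setT (fun t => \1_(h n @^-1` [set y]) (X t) * g t).
    apply: measurable_funM => //; apply: measurableT_comp => //.
  transitivity (\int[mu]_t (\sum_(y \in range (h n))
      (y * (\1_(h n @^-1` [set y]) (X t) * g t))%:E))%E.
    apply: eq_integral => t _; rewrite fsumEFin//; congr (_%:E).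
    under eq_fsbigr do rewrite mulrA.
    by rewrite {1}(fimfunE (h n)) mulr_fsuml.
  rewrite ge0_integral_fsum//.
  - apply: eq_fsbigr => y; rewrite inE => -[x _ <-].
    under eq_integral do rewrite EFinM.
    rewrite ge0_integralZl_EFin//; last exact/measurable_EFinP.
    by move=> t _; rewrite lee_fin mulr_ge0.
  - by move=> y; apply/measurable_EFinP; exact: measurable_funM.
  - move=> y t _; rewrite mulrA EFinM mule_ge0 ?lee_fin// -lee_fin EFinM.
    exact: nnfun_muleindic_ge0.
by rewrite !sumE//; apply: eq_fsbigr => y _; rewrite eq12.
Qed.

(** Finiteness of the individual expectations is used because the product of the
    other expectations serves as a constant real weight in
    [eq_weight_integral]. *)
Lemma expectation_prod_indep d (T : measurableType d) (R : realType)
    (P : probability T R) (I : finType) (X : I -> {RV P >-> R})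
    (g : I -> R -> R) :
  independent_RVs X ->
  (forall i, measurable_fun setT (g i)) -> (forall i r, 0 <= g i r) ->
  (forall i, (\int[P]_t (g i (X i t))%:E < +oo)%E) ->
  (\int[P]_t (\prod_i g i (X i t))%:E =
   \prod_i \int[P]_t (g i (X i t))%:E)%E.
Proof.
move=> indX.
(* The factors outside s are indicators, those in s are arbitrary: the induction
   on s starts from the product rule for events and frees one factor at a
   time. *)
suff prodE (s : seq I) : forall (g : I -> R -> R) (A : I -> set R),
    (forall i, measurable (A i)) ->
    (forall i, i \notin s -> g i = \1_(A i)) ->
    (forall i, measurable_fun setT (g i)) -> (forall i r, 0 <= g i r) ->
    (forall i, (\int[P]_t (g i (X i t))%:E < +oo)%E) ->
    (\int[P]_t (\prod_i g i (X i t))%:E =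
     \prod_i \int[P]_t (g i (X i t))%:E)%E.
  by apply: (prodE (enum I) g (fun=> setT)) => // i; rewrite mem_enum.
have mX i : measurable_fun setT (X i) by [].
have int_indic i B : measurable B ->
    (\int[P]_t (\1_B (X i t))%:E = P (X i @^-1` B))%E.
  move=> mB; rewrite -[in RHS](setIT (X i @^-1` B)) -integral_indic//.
  by rewrite -[_ @^-1` _]setTI; exact: mX.
elim: s => [|k s IHs] {}g A mA gA mg g0 gfin.
  have mXA i : measurable (X i @^-1` A i).
    by rewrite -[_ @^-1` _]setTI; exact: mX.
  pose B := [set t | forall i, i \in [set: I]%SET -> A i (X i t)].
  have indicB t : \1_B t = \prod_i \1_(A i) (X i t) :> R.
    rewrite indicE; have [|tNB] := boolP (t \in B).
      rewrite inE => tB; rewrite big1// => i _.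
      by rewrite indicE mem_set//; apply: tB; rewrite inE.
    have : exists i, ~ A i (X i t).
      apply/existsNP => tA; move/negP: tNB; apply.
      by rewrite inE => i _; exact: tA.
    by move=> [i NAi]; rewrite (bigD1 i)//= indicE memNset// mul0r.
  have mB : measurable B.
    rewrite (_ : B = \bigcap_(i in [set: I]) (X i @^-1` A i)); last first.
      by apply/seteqP; split=> t tB i _; apply: tB => //; rewrite inE.
    by apply: fin_bigcap_measurable => // i _; exact: mXA.
  transitivity (P B).
    rewrite -[in RHS](setIT B) -integral_indic//.
    apply: eq_integral => t _; rewrite indicB.
    by congr (_%:E); apply: eq_bigr => i _; rewrite gA.
  rewrite indX//; apply: eq_big => [i|i _]; first by rewrite inE.
  by rewrite gA// int_indic.
have mprod (f : I -> R -> R) : (forall i, measurable_fun setT (f i)) ->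
    measurable_fun setT (fun t => \prod_(i | i != k) f i (X i t)).
  move=> mf; under eq_fun do rewrite -big_filter.
  by apply: measurable_prod => i _; exact: measurableT_comp.
have int_ge0 i : (0 <= \int[P]_t (g i (X i t))%:E)%E.
  by apply: integral_ge0 => t _; rewrite lee_fin.
pose c := fine (\prod_(i | i != k) \int[P]_t (g i (X i t))%:E)%E.
have cE : (c%:E = \prod_(i | i != k) \int[P]_t (g i (X i t))%:E)%E.
  by rewrite fineK//; apply: prode_fin_num => i _; rewrite ge0_fin_numE.
have c0 : 0 <= c by rewrite fine_ge0//; apply: prode_ge0.
transitivity (\int[P]_t (g k (X k t) * \prod_(i | i != k) g i (X i t))%:E)%E.
  by apply: eq_integral => t _; rewrite (bigD1 k).
(* For an indicator in place of g k, the two weights agree by the induction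
   hypothesis; c is the constant that independence predicts. *)
rewrite (@eq_weight_integral _ _ _ P (X k) _ (cst c))//.
- under eq_integral do rewrite mulrC EFinM.
  rewrite ge0_integralZl_EFin//; last 2 first.
  + by move=> t _; rewrite lee_fin.
  + by apply/measurable_EFinP; exact: measurableT_comp.
  by rewrite cE muleC [RHS](bigD1 k).
- exact: mprod.
- by move=> t; rewrite prodr_ge0.
move=> B mB.
pose gB i := if i == k then \1_B : R -> R else g i.
transitivity (\int[P]_t (\prod_i gB i (X i t))%:E)%E.
  apply: eq_integral => t _; rewrite [in RHS](bigD1 k)//= /gB eqxx.
  by congr (_ * _)%:E; apply: eq_bigr => i /negbTE ->.
rewrite (IHs gB (fun i => if i == k then B else A i)); last first.
- move=> i; rewrite /gB; case: eqP => [->|//].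
  rewrite int_indic//; apply: le_lt_trans (ltry 1); apply: probability_le1.
  by rewrite -[_ @^-1` _]setTI; exact: mX.
- by move=> i r; rewrite /gB; case: ifP.
- by move=> i; rewrite /gB; case: ifP.
- move=> i iNs; rewrite /gB; case: eqP => // /eqP ik.
  by rewrite gA// inE negb_or ik.
- by move=> i; case: ifP.
rewrite (bigD1 k)//= /gB eqxx.
under eq_bigr => i /negbTE -> do [].
rewrite -cE; under [RHS]eq_integral do rewrite mulrC EFinM.
rewrite ge0_integralZl_EFin//; first by rewrite muleC.
by apply/measurable_EFinP; exact: measurableT_comp.
Qed.

(** * Tail bounds *)

Lemma chernoff_sum d (T : measurableType d) (R : realType)
    (P : probability T R) (I : finType) (X : I -> {RV P >-> R}) (h x : R) :
  independent_RVs X -> 0 < h -> (forall i, ('M_P (X i) h < +oo)%E) ->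
  (P [set t | (x <= \sum_i X i t)%R]
     <= (\prod_i 'M_P (X i) h) * (expR (- (h * x)))%:E)%E.
Proof.
move=> indX h0 Mfin.
have mS : measurable_fun setT (fun t => \sum_i X i t).
  by apply: measurable_sum => i.
pose S : {RV P >-> R} := HB.pack (fun t => \sum_i X i t)
  (isMeasurableFun.Build _ _ _ _ _ mS).
apply: le_trans (chernoff S x h0) _.
rewrite le_eqVlt; apply/orP; left; apply/eqP; congr (_ * _)%E.
have ME (Y : T -> R) :
    ('M_P Y h = \int[P]_t ((fun r => expR (r * h)) (Y t))%:E)%E.
  by rewrite /mmt_gen_fun unlock.
rewrite (eq_bigr _ (fun i _ => ME (X i))) ME.
rewrite -(expectation_prod_indep (g := fun _ r => expR (r * h)))//.
- apply: eq_integral => t _; congr (_%:E).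
  by rewrite /= mulr_suml expR_sum.
- move=> i; apply: measurableT_comp => //; exact: measurable_funM.
- by move=> i; rewrite -ME.
Qed.

(** The endpoint [h = 1 / M] is reached from smaller values of [h]: the moment
    generating functions may be controlled only below it. *)
Lemma tail_le_expR d (T : measurableType d) (R : realType)
    (P : probability T R) (I : finType) (X : I -> {RV P >-> R}) (eps M : R)
    (a : I -> R) (h x : R) :
  0 <= eps -> independent_RVs X -> (forall i, ('E_P[X i] = 0)%E) ->
  (forall i, sub_exponential P (X i)) ->
  (forall i, orlicz_norm P (@psi11 R) eps (X i) = (a i)%:E) ->
  (forall i, a i <= M) -> 0 < M -> 0 < h -> h * M <= 1 ->
  (P [set t | (x <= \sum_i X i t)%R] <=
    (expR (- (h * x) + h ^+ 2 * (eps * \sum_i a i ^+ 2)))%:E)%E.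
Proof.
move=> eps0 indX EX subX normX aM M0 h0 hM1.
set B2 := eps * _.
pose bnd h' := - (h' * x) + h' ^+ 2 * B2.
have bnd_cvg : (expR (bnd h'))%:E @[h' --> h^'-] --> (expR (bnd h))%:E.
  apply: cvg_EFin; first exact: nearW.
  apply: cvg_at_left_filter.
  apply: continuous_cvg; first exact: continuous_expR.
  apply: cvgD; first by apply: cvgN; apply: cvgMr_tmp; exact: cvg_id.
  by apply: cvgMr_tmp; apply: cvgM; exact: cvg_id.
apply: (cvge_to_ge bnd_cvg).
near=> h'.
have h'0 : 0 < h' by near: h'; exact: nbhs_left_gt.
have h'h : h' < h by near: h'; exact: nbhs_left_lt.
have mgfX i : ('M_P (X i) h' <= (expR (eps * (h' * a i) ^+ 2))%:E)%E.
  apply: mgf_le_orlicz_norm => //.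
  apply: le_lt_trans (ler_wpM2l (ltW h'0) (aM i)) _.
  by apply: lt_le_trans hM1; rewrite ltr_pM2r.
apply: le_trans (chernoff_sum x indX h'0 _) _ => [i|].
  exact: le_lt_trans (mgfX i) (ltry _).
rewrite /bnd addrC expRD EFinM lee_wpmul2r ?lee_fin ?expR_ge0//.
have mgf_ge0 i : (0 <= 'M_P (X i) h')%E.
  by apply: expectation_ge0 => t; exact: expR_ge0.
have mgfE i : ('M_P (X i) h' = (fine ('M_P (X i) h'))%:E)%E.
  by rewrite fineK// ge0_fin_numE// (le_lt_trans (mgfX i))// ltry.
rewrite (eq_bigr _ (fun i _ => mgfE i)) prodEFin lee_fin.
rewrite /B2 mulrCA mulr_sumr mulr_sumr expR_sum.
apply: ler_prod => i _; rewrite fine_ge0//= -lee_fin -mgfE.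
by have := mgfX i; rewrite exprMn.
Unshelve. all: by end_near. Qed.

Unset Implicit Arguments.

Theorem theorem2 (d : measure_display) (T : measurableType d) (R : realType)
    (P : probability T R) (eps : R) (n : nat) (X : 'I_n -> {RV P >-> R})
    (eps_gt0 : 0 < eps)
    (indepX : independent_RVs X)
    (meanX : forall i, ('E_P[X i] = 0)%E)
    (subexpX : forall i, sub_exponential P (X i)) :
  let B2e : \bar R := Bsq P eps (fun i => X i : T -> R) in
  let Me : \bar R := Mmax P eps (fun i => X i : T -> R) in
  let B2 : R := fine B2e in
  let M : R := fine Me in
  ((0 < Me < +oo)%E <-> (0 < B2e < +oo)%E) /\
  ((0 < Me < +oo)%E -> forall x : R, 0 <= x ->
    [/\ x <= 2 * B2 / M ->
          (P [set t | (x <= \sum_(i < n) X i t)%R]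
             <= (expR (- (x ^+ 2 / (4 * B2))))%:E)%E,
        2 * B2 / M <= x ->
          (P [set t | (x <= \sum_(i < n) X i t)%R]
             <= (expR (- (x / M - B2 / M ^+ 2)))%:E)%E,
        x <= 2 * B2 / M ->
          expR (- (x ^+ 2 / (4 * B2))) <=
          expR (- Num.min (x ^+ 2 / (4 * B2)) (x / (2 * M)))
      & 2 * B2 / M <= x ->
          expR (- (x / M - B2 / M ^+ 2)) <=
          expR (- Num.min (x ^+ 2 / (4 * B2)) (x / (2 * M)))]).
Proof.
move=> B2e Me B2 M.
pose a i := fine (orlicz_norm P (@psi11 R) eps (X i)).
have normX i : orlicz_norm P (@psi11 R) eps (X i) = (a i)%:E.
  rewrite fineK// ge0_fin_numE ?orlicz_norm_ge0//.
  exact: sub_exponential_psi11_norm_lty.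
have a_ge0 i : 0 <= a i by rewrite -lee_fin -normX orlicz_norm_ge0.
have B2eE : B2e = (eps * \sum_i a i ^+ 2)%:E.
  rewrite /B2e /Bsq EFinM -sumEFin; congr (_ * _)%E.
  by apply: eq_bigr => i _; rewrite normX EFin_expe.
have B2E : B2 = eps * \sum_i a i ^+ 2 by rewrite /B2 B2eE.
have Me_lty : (Me < +oo)%E.
  by apply: bigmax_lt => // i _; rewrite normX ltry.
have le_aMe i : ((a i)%:E <= Me)%E.
  by rewrite -normX /Me /Mmax; exact: le_bigmax.
have Me_gt0 : (0 < Me)%E -> exists i, 0 < a i.
  move=> Me0; apply: contrapT => /forallNP a_le0.
  suff : (Me <= 0)%E by rewrite leNgt Me0.
  apply: bigmax_le => // i _; rewrite normX lee_fin leNgt; exact/negP.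
have B2_gt0 i : 0 < a i -> 0 < B2.
  move=> ai0; rewrite B2E mulr_gt0// (bigD1 i)//=.
  by rewrite ltr_pwDl ?exprn_gt0// sumr_ge0// => j _; rewrite sqr_ge0.
split.
  rewrite Me_lty andbT B2eE ltry andbT lte_fin -B2E; split.
    by move=> /Me_gt0[i /B2_gt0].
  move=> B20; suff [i ai0] : exists i, 0 < a i.
    by apply: lt_le_trans (le_aMe i); rewrite lte_fin.
  apply: contrapT => /forallNP a_le0; move: B20.
  rewrite B2E big1 ?mulr0 ?ltxx// => i _.
  have /eqP -> : a i == 0; last by rewrite expr0n.
  by rewrite eq_le a_ge0 andbT leNgt; exact/negP.
move=> /andP[Me0 _] x x0.
have [i0 ai0] := Me_gt0 Me0; have B20 := B2_gt0 _ ai0.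
have MeE : Me = M%:E by rewrite fineK// ge0_fin_numE// ltW.
have M0 : 0 < M by rewrite -lte_fin -MeE.
have aM i : a i <= M by rewrite -lee_fin -MeE.
have tail h : 0 < h -> h * M <= 1 ->
    (P [set t | (x <= \sum_(i < n) X i t)%R] <=
      (expR (- (h * x) + h ^+ 2 * B2))%:E)%E.
  by rewrite B2E; apply: tail_le_expR => //; exact: ltW.
have M_neq0 : M != 0 by rewrite gt_eqF.
have B2_neq0 : B2 != 0 by rewrite gt_eqF.
split.
(* For x = 0 the optimal h vanishes, and the bound is the trivial one. *)
- move=> xB; have [x_gt0|] := ltP 0 x; last first.
    move=> x_le0; have -> : x = 0 by apply/eqP; rewrite eq_le x_le0 x0.
    rewrite expr0n mul0r oppr0 expR0; apply: probability_le1.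
    rewrite (_ : [set t | _] =
        setT `&` (fun t => \sum_(i < n) X i t) @^-1` `[0, +oo[).
      have mS : measurable_fun setT (fun t => \sum_(i < n) X i t).
        exact: measurable_sum.
      exact: mS.
    by rewrite setTI; apply/seteqP; split=> t /=; rewrite in_itv/= andbT.
  have h0 : 0 < x / (2 * B2) by rewrite divr_gt0// mulr_gt0.
  have hM : x / (2 * B2) * M <= 1.
    by rewrite mulrAC ler_pdivrMr ?mulr_gt0// mul1r -ler_pdivlMr.
  apply: le_trans (tail _ h0 hM) _; rewrite lee_fin ler_expR le_eqVlt.
  by apply/orP; left; apply/eqP; field.
- move=> _; have hM : M^-1 * M <= 1 by rewrite mulVf.
  apply: le_trans (tail M^-1 _ hM) _; first by rewrite invr_gt0.
  rewrite lee_fin ler_expR le_eqVlt; apply/orP; left; apply/eqP; field.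
  by [].
- by move=> _; rewrite ler_expR lerN2 ge_min lexx.
- move=> Bx; rewrite ler_expR lerN2 ge_min; apply/orP; right.
  rewrite -subr_ge0 (_ : _ - _ = (x - 2 * B2 / M) / (2 * M)); last by field.
  by rewrite divr_ge0// ?subr_ge0// mulr_ge0// ltW.
Qed.
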